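(* Consider an $I\times J$ table of positive cell probabilities $p_{kl}$ ($1\le k\le I$, $1\le l\le J$) represented by the saturated LP log-linear copula model $$\frac{p_{kl}}{p_{k+}\,p_{+l}}=\exp\Bigl(\mu_0+\sum_{j=1}^{M}\mu_j\,\phi_{jk}\,\psi_{jl}\Bigr),\qquad M=\min(I-1,J-1),$$ with intrinsic association parameters $\mu_1,\dots,\mu_M$ and row and column scores $\phi_{jk},\psi_{jl}$ as in the context. For the two-by-two subtable formed by rows $k,k'$ and columns $l,l'$, let $$\vartheta_{kl,k'l'}=\frac{p_{kl}\,p_{k'l'}}{p_{kl'}\,p_{k'l}}$$ be its odds-ratio. Then $$\log\vartheta_{kl,k'l'}=\sum_{j=1}^{M}\mu_j\,(\phi_{jk}-\phi_{jk'})(\psi_{jl}-\psi_{jl'}).$$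
   Context: $p_{k+}=\sum_l p_{kl}$ and $p_{+l}=\sum_k p_{kl}$ are the row and column marginals. The scores are real numbers satisfying, for all $j\ne j'$, $$\sum_k\phi_{jk}p_{k+}=\sum_l\psi_{jl}p_{+l}=0,\qquad \sum_k\phi_{jk}^2p_{k+}=\sum_l\psi_{jl}^2p_{+l}=1,$$ $$\sum_k\phi_{jk}\phi_{j'k}p_{k+}=\sum_l\psi_{jl}\psi_{j'l}p_{+l}=0.$$ The parameters are non-increasing, $\mu_1\ge\mu_2\ge\cdots\ge\mu_M\ge 0$, and satisfy $$\mu_j=\sum_{k=1}^{I}\sum_{l=1}^{J}(\log p_{kl})\,p_{k+}\,p_{+l}\,\phi_{jk}\,\psi_{jl},\qquad j=1,\dots,M.$$ *)

(* Defs.v *)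
From mathcomp Require Import all_boot all_order all_algebra.
From mathcomp Require Import reals sequences exp.
Set Implicit Arguments.
Unset Strict Implicit.
Unset Printing Implicit Defensive.
Import Order.TTheory GRing.Theory Num.Theory.
Local Open Scope ring_scope.

Definition row_marginal (R : realType) (I J : nat) (p : 'M[R]_(I, J))
  (k : 'I_I) : R := \sum_l p k l.

Definition col_marginal (R : realType) (I J : nat) (p : 'M[R]_(I, J))
  (l : 'I_J) : R := \sum_k p k l.

Definition positive_prob_table (R : realType) (I J : nat) (p : 'M[R]_(I, J))
  : Prop := (forall k l, 0 < p k l) /\ \sum_k \sum_l p k l = 1.

(* Scores are stored by rows: [s j k] is the j-th score of category k, and [w]
   is the marginal distribution with respect to which they are normalized. *)
Definition standardized_scores (R : realType) (M n : nat) (w : 'I_n -> R)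
  (s : 'M[R]_(M, n)) : Prop :=
  [/\ forall j, \sum_k s j k * w k = 0,
      forall j, \sum_k s j k ^+ 2 * w k = 1
    & forall j j', j != j' -> \sum_k s j k * s j' k * w k = 0].

(* Number of terms of the saturated model, min(I-1, J-1).  The truncated
   predecessor at 0 is harmless: an empty table cannot have total mass 1. *)
Definition saturated_rank (I J : nat) : nat := minn I.-1 J.-1.

(* Indices are 0-based: the entry [mu j] is the (j+1)-st intrinsic association
   parameter, and the constant term is the separate real [mu0]. *)
Record saturated_LP_model (R : realType) (I J : nat) (p : 'M[R]_(I, J))
  (mu0 : R) (mu : 'I_(saturated_rank I J) -> R)
  (phi : 'M[R]_(saturated_rank I J, I))
  (psi : 'M[R]_(saturated_rank I J, J)) : Prop := SaturatedLPModel {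
  LP_prob : positive_prob_table p;
  LP_row_scores : standardized_scores (row_marginal p) phi;
  LP_col_scores : standardized_scores (col_marginal p) psi;
  LP_mu_noninc : forall j j' : 'I_(saturated_rank I J),
    (j <= j')%N -> mu j' <= mu j;
  LP_mu_ge0 : forall j, 0 <= mu j;
  LP_muE : forall j, mu j =
    \sum_k \sum_l
      ln (p k l) * row_marginal p k * col_marginal p l * phi j k * psi j l;
  LP_copulaE : forall k l,
    p k l / (row_marginal p k * col_marginal p l) =
      expR (mu0 + \sum_j mu j * phi j k * psi j l)
}.

Definition odds_ratio (R : realType) (I J : nat) (p : 'M[R]_(I, J))
  (k k' : 'I_I) (l l' : 'I_J) : R :=
  (p k l * p k' l') / (p k l' * p k' l).

(* Main.v *)
Require Import Defs.
From mathcomp Require Import all_boot all_order all_algebra.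
From mathcomp Require Import reals sequences exp.
From mathcomp Require Import ring.
Set Implicit Arguments.
Unset Strict Implicit.
Unset Printing Implicit Defensive.
Import Order.TTheory GRing.Theory Num.Theory.
Local Open Scope ring_scope.

(** The index [i] witnesses that the sum is nonempty; an empty sum would be 0. *)
Lemma psumr_gt0 (R : numDomainType) (n : nat) (F : 'I_n -> R) (i : 'I_n) :
  (forall j, 0 < F j) -> 0 < \sum_j F j.
Proof.
move=> F_gt0; rewrite (bigD1 i) //= ltr_wpDr //.
by apply: sumr_ge0 => j _; exact: ltW.
Qed.

Lemma ln_odds_ratio (R : realType) (I J : nat) (p : 'M[R]_(I, J))
    (k k' : 'I_I) (l l' : 'I_J) : (forall a b, 0 < p a b) ->
  ln (odds_ratio p k k' l l') =
    ln (p k l) + ln (p k' l') - (ln (p k l') + ln (p k' l)).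
Proof.
move=> p_gt0; rewrite /odds_ratio ln_div ?posrE ?mulr_gt0 //.
by rewrite !lnM ?posrE.
Qed.

Lemma ln_LP_model (R : realType) (I J : nat) (p : 'M[R]_(I, J)) (mu0 : R)
    (mu : 'I_(saturated_rank I J) -> R)
    (phi : 'M[R]_(saturated_rank I J, I))
    (psi : 'M[R]_(saturated_rank I J, J)) (k : 'I_I) (l : 'I_J) :
  saturated_LP_model p mu0 mu phi psi ->
  ln (p k l) = mu0 + \sum_j mu j * phi j k * psi j l
    + (ln (row_marginal p k) + ln (col_marginal p l)).
Proof.
move=> model; have [p_gt0 _] := LP_prob model.
(* The cell [(k, l)] itself shows that row [k] and column [l] are nonempty, so both marginals have
   genuine logarithms. *)
have r_gt0 : 0 < row_marginal p k by apply: (psumr_gt0 l) => b.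
have c_gt0 : 0 < col_marginal p l by apply: (psumr_gt0 k) => a.
have /(congr1 (@ln R)) := LP_copulaE model k l.
rewrite expRK ln_div ?posrE ?mulr_gt0 // lnM ?posrE // => <-.
by rewrite subrK.
Qed.

Theorem theorem2 (R : realType) (I J : nat) (p : 'M[R]_(I, J)) (mu0 : R)
    (mu : 'I_(saturated_rank I J) -> R)
    (phi : 'M[R]_(saturated_rank I J, I))
    (psi : 'M[R]_(saturated_rank I J, J))
    (Hmodel : saturated_LP_model p mu0 mu phi psi)
    (k k' : 'I_I) (l l' : 'I_J) :
  ln (odds_ratio p k k' l l') =
    \sum_(j < saturated_rank I J)
      mu j * (phi j k - phi j k') * (psi j l - psi j l').
Proof.
have [p_gt0 _] := LP_prob Hmodel.
rewrite ln_odds_ratio // !(ln_LP_model _ _ Hmodel).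
(* Expanding the product of differences for each [j] gives the four interaction sums with the signs
   of the odds-ratio; [mu0] and the log marginals then cancel in the final [ring]. *)
have -> : \sum_j mu j * (phi j k - phi j k') * (psi j l - psi j l') =
    \sum_j mu j * phi j k * psi j l + \sum_j mu j * phi j k' * psi j l'
    - (\sum_j mu j * phi j k * psi j l' + \sum_j mu j * phi j k' * psi j l).
  by rewrite -!big_split -sumrB; apply: eq_bigr => j _ /=; ring.
by ring.
Qed.
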